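(* Let $K=\mathbb{Q}(\sqrt{2})$ with ring of integers $O_K$, and let $$f_1(q):=\sum_{n=0}^{\infty}\frac{q^{\frac{n^2+n}{2}}(q)_{2n}}{(-q)_n(q)_{2n+1}}.$$ Then $$q\,f_1(q^{16})=\sum_{\substack{\mathbf{a}\subset O_K\\ \mathcal{N}(\mathbf{a})\equiv 1 \pmod{16}}}q^{\mathcal{N}(\mathbf{a})},$$ where the sum runs over the nonzero ideals $\mathbf{a}$ of $O_K$ with $\mathcal{N}(\mathbf{a})\equiv 1\pmod{16}$.
   Context: Identities are between formal power series in $q$ (equivalently, for $|q|<1$). Notation: $(a)_n=(a;q)_n:=\prod_{j=0}^{n-1}(1-aq^j)$, so that $(q)_n=\prod_{j=1}^n(1-q^j)$ and $(-q)_n=\prod_{j=1}^n(1+q^j)$. For an ideal $\mathbf{a}$ of $O_K$, $\mathcal{N}(\mathbf{a})=|O_K/\mathbf{a}|$ is its norm. *)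

(* Defs.v *)
From HB Require Import structures.
From mathcomp Require Import all_boot all_order all_algebra all_field.
From mathcomp Require Import finmap boolp classical_sets functions cardinality.
From mathcomp Require Import fsbigop.

Set Implicit Arguments.
Unset Strict Implicit.
Unset Printing Implicit Defensive.

Import Order.TTheory GRing.Theory Num.Theory.
Local Open Scope classical_set_scope.
Local Open Scope ring_scope.

(* Formal power series over a ring R, as coefficient sequences.  The record   *)
(* keeps the Cauchy product apart from the pointwise ring structure that      *)
(* MathComp-Classical puts on the function type nat -> R.                     *)
Record fps (R : Type) := FPS { coefs : nat -> R }.

Notation "{ 'fps' R }" := (fps R) (at level 0, format "{ 'fps'  R }").

Lemma fpsP (R : Type) (f g : {fps R}) : coefs f =1 coefs g -> f = g.
Proof. by case: f => f; case: g => g /= /funext ->. Qed.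

HB.instance Definition _ (R : Type) := gen_eqMixin {fps R}.
HB.instance Definition _ (R : Type) := gen_choiceMixin {fps R}.

Section FpsZmod.
Variable R : zmodType.
Implicit Types f g h : {fps R}.

Definition fps_zero : {fps R} := FPS (fun=> 0).
Definition fps_opp f : {fps R} := FPS (fun k => - coefs f k).
Definition fps_add f g : {fps R} := FPS (fun k => coefs f k + coefs g k).

Fact fps_addA : associative fps_add.
Proof. by move=> f g h; apply: fpsP => k /=; rewrite addrA. Qed.
Fact fps_addC : commutative fps_add.
Proof. by move=> f g; apply: fpsP => k /=; rewrite addrC. Qed.
Fact fps_add0 : left_id fps_zero fps_add.
Proof. by move=> f; apply: fpsP => k /=; rewrite add0r. Qed.
Fact fps_addN : left_inverse fps_zero fps_opp fps_add.
Proof. by move=> f; apply: fpsP => k /=; rewrite addNr. Qed.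

HB.instance Definition _ :=
  GRing.isZmodule.Build {fps R} fps_addA fps_addC fps_add0 fps_addN.

End FpsZmod.

Section FpsRing.
Variable R : comNzRingType.
Implicit Types f g h : {fps R}.

Definition fps_one : {fps R} := FPS (fun k => (k == 0)%:R).
Definition fps_mul f g : {fps R} :=
  FPS (fun k => \sum_(i < k.+1) coefs f i * coefs g (k - i)).

Definition fps_trunc n f : {poly R} := \poly_(i < n) coefs f i.

Lemma coefs_mul_trunc n f g k : (k < n)%N ->
  coefs (fps_mul f g) k = (fps_trunc n f * fps_trunc n g)`_k.
Proof.
move=> ltkn; rewrite coefM /=; apply: eq_bigr => i _; rewrite !coef_poly.
have le_ik : (i <= k)%N by rewrite -ltnS.
by rewrite (leq_ltn_trans le_ik ltkn) (leq_ltn_trans (leq_subr i k) ltkn).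
Qed.

Fact fps_mulC : commutative fps_mul.
Proof.
move=> f g; apply: fpsP => k.
by rewrite !(coefs_mul_trunc _ _ (ltnSn k)) mulrC.
Qed.

Fact fps_mulA : associative fps_mul.
Proof.
have aux f g h k : coefs (fps_mul (fps_mul f g) h) k =
    (fps_trunc k.+1 f * fps_trunc k.+1 g * fps_trunc k.+1 h)`_k.
  rewrite coefM /=; apply: eq_bigr => i _; congr (_ * _).
    exact: coefs_mul_trunc.
  by rewrite coef_poly ltnS leq_subr.
move=> f g h; apply: fpsP => k; rewrite fps_mulC !aux; congr (_`_k).
by rewrite mulrC mulrA.
Qed.

Fact fps_mul1 : left_id fps_one fps_mul.
Proof.
move=> f; apply: fpsP => k /=; rewrite big_ord_recl /= mul1r subn0.
by rewrite big1 ?addr0 // => i _; rewrite mul0r.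
Qed.

Fact fps_mulDl : left_distributive fps_mul +%R.
Proof.
move=> f g h; apply: fpsP => k /=.
by rewrite -big_split; apply: eq_bigr => i _ /=; rewrite mulrDl.
Qed.

Fact fps_one_neq0 : fps_one != 0.
Proof.
apply/eqP => /(congr1 (fun f => coefs f 0)) /= /eqP.
by rewrite oner_eq0.
Qed.

HB.instance Definition _ := GRing.Zmodule_isComNzRing.Build {fps R}
  fps_mulA fps_mulC fps_mul1 fps_mulDl fps_one_neq0.

Definition fpsX : {fps R} := FPS (fun k => (k == 1)%:R).

(* The series f(q^m), for m > 0. *)
Definition fps_subst_pow (m : nat) f : {fps R} :=
  FPS (fun k => if (m %| k)%N then coefs f (k %/ m) else 0).

Lemma coefs0M f g : coefs (f * g) 0 = coefs f 0 * coefs g 0.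
Proof. by rewrite /= big_ord_recl big_ord0 addr0 subnn. Qed.

Lemma coefsXnM n f k :
  coefs (fpsX ^+ n * f) k = if (k < n)%N then 0 else coefs f (k - n).
Proof.
elim: n k => [|n IHn] k; first by rewrite expr0 mul1r subn0.
rewrite exprS -mulrA; move: (fpsX ^+ n * f) (IHn) => g {}IHn.
rewrite /= big_ord_recl /= mul0r add0r.
case: k => [|k]; first by rewrite big_ord0.
rewrite big_ord_recl /= mul1r big1; last by move=> i _; rewrite mul0r.
by rewrite addr0 -[bump 0 0]/1%N subSS subn0 IHn ltnS subSS.
Qed.

End FpsRing.

Section FpsUnit.
Variable R : comUnitRingType.
Implicit Types f g h : {fps R}.

(* The first n coefficients of f^-1, from the recurrence                      *)
(*   g_n = - f_0^-1 * \sum_(i < n) f_(n - i) * g_i  (n > 0).                  *)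
Fixpoint fps_inv_seq f (n : nat) : seq R :=
  if n isn't m.+1 then [::] else
  let s := fps_inv_seq f m in
  rcons s ((coefs f 0)^-1 *
    ((m == 0)%:R - \sum_(i < m) coefs f (m - i) * nth 0 s i)).

Definition fps_unit : {pred {fps R}} :=
  [pred f | coefs f 0 \is a GRing.unit].

Definition fps_inv f : {fps R} :=
  if f \in fps_unit then FPS (fun k => nth 0 (fps_inv_seq f k.+1) k) else f.

Lemma size_fps_inv_seq f n : size (fps_inv_seq f n) = n.
Proof. by elim: n => //= n IHn; rewrite size_rcons IHn. Qed.

Lemma nth_fps_inv_seq f m n : (m < n)%N ->
  nth 0 (fps_inv_seq f n) m = nth 0 (fps_inv_seq f m.+1) m.
Proof.
elim: n => // n IHn; rewrite ltnS leq_eqVlt => /predU1P[-> // | ltmn].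
by rewrite [fps_inv_seq f n.+1]/= nth_rcons size_fps_inv_seq ltmn IHn.
Qed.

Fact fps_mulVx : {in fps_unit, left_inverse 1 fps_inv *%R}.
Proof.
move=> f Uf; rewrite /fps_inv Uf; apply: fpsP => k.
have Uf0 : coefs f 0 \is a GRing.unit := Uf.
have inv_nth i : (i < k)%N ->
    nth 0 (fps_inv_seq f i.+1) i = nth 0 (fps_inv_seq f k) i.
  by move=> ltik; rewrite -(nth_fps_inv_seq f ltik).
rewrite /= big_ord_recr /= subnn.
rewrite nth_rcons size_fps_inv_seq ltnn eqxx.
rewrite [_ * coefs f 0]mulrC mulrA divrr // mul1r addrC.
rewrite [X in _ + X](eq_bigr
    (fun i : 'I_k => coefs f (k - i) * nth 0 (fps_inv_seq f k) i)).
  by rewrite subrK.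
by move=> i _; rewrite mulrC -inv_nth //= nth_rcons size_fps_inv_seq ltnn eqxx.
Qed.

Fact fps_unitPl f g : g * f = 1 -> fps_unit f.
Proof.
move=> gf1; apply/unitrPr; exists (coefs g 0).
by rewrite mulrC -coefs0M gf1.
Qed.

Fact fps_inv_out : {in [predC fps_unit], fps_inv =1 id}.
Proof. by move=> f; rewrite inE /= /fps_inv => /negbTE->. Qed.

HB.instance Definition _ := GRing.ComNzRing_hasMulInverse.Build {fps R}
  fps_mulVx fps_unitPl fps_inv_out.

Lemma fps_unitE f : (f \is a GRing.unit) = (coefs f 0 \is a GRing.unit).
Proof. by []. Qed.

End FpsUnit.

(* Sums of families of power series: a family is summable when, for each k,   *)
(* only finitely many of its members have a nonzero coefficient of degree k.  *)
(* The value of fps_sum is meaningful for summable families.                  *)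
Section FpsSum.
Variables (R : zmodType) (I : choiceType).

Definition fps_summable (A : set I) (F : I -> {fps R}) :=
  forall k, finite_set [set i | A i /\ coefs (F i) k != 0].

Definition fps_sum (A : set I) (F : I -> {fps R}) : {fps R} :=
  FPS (fun k => \sum_(i \in A) coefs (F i) k).

End FpsSum.

Definition qpoch (R : nzRingType) (a q : R) (n : nat) : R :=
  \prod_(j < n) (1 - a * q ^+ j).

Local Notation q := (fpsX int).

Definition f1_term (n : nat) : {fps int} :=
  q ^+ ((n ^ 2 + n) %/ 2) * qpoch q q (2 * n) /
  (qpoch (- q) q n * qpoch q q (2 * n + 1)).

Definition f1 : {fps int} := fps_sum [set: nat] f1_term.

Lemma qpoch_fps_unit (a b : {fps int}) n :
  coefs a 0 = 0 -> qpoch a b n \is a GRing.unit.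
Proof.
move=> a0; apply: rpred_prod => j _; rewrite fps_unitE.
have -> : coefs (1 - a * b ^+ j) 0 = 1 - coefs (a * b ^+ j) 0 by [].
by rewrite coefs0M a0 mul0r subr0 unitr1.
Qed.

Lemma f1_term_den_unit n :
  qpoch (- q) q n * qpoch q q (2 * n + 1) \is a GRing.unit.
Proof. by rewrite unitrM !qpoch_fps_unit. Qed.

Lemma f1_summable : fps_summable [set: nat] f1_term.
Proof.
move=> k; apply: (sub_finite_set _ (finite_II k.+1)) => n [_].
rewrite /f1_term -mulrA coefsXnM; case: ltnP; rewrite ?eqxx // => le_nk _.
rewrite /mkset ltnS; apply: leq_trans le_nk.
rewrite leq_divRL // muln2 -addnn leq_add2r.
by case: n => // n; rewrite -mulnn leq_pmulr.
Qed.

Section RingOfIntegers.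
Variable K : fieldExtType rat.

Definition int_pred : {pred K} :=
  [pred x : K | `[< integralOver (intr : int -> K) x >]].

Fact int_pred_subring : subring_closed int_pred.
Proof.
split=> [|x y /asboolP Ix /asboolP Iy|x y /asboolP Ix /asboolP Iy].
- by apply/asboolP; apply: integral1.
- by apply/asboolP; apply: integral_sub.
- by apply/asboolP; apply: integral_mul.
Qed.

Record ringOfIntegers :=
  RingOfIntegers { int_val : K; _ : int_val \in int_pred }.

HB.instance Definition _ := [isSub for int_val].
HB.instance Definition _ := [Choice of ringOfIntegers by <:].
HB.instance Definition _ :=
  GRing.SubChoice_isSubComNzRing.Build K int_pred ringOfIntegers
    int_pred_subring.

End RingOfIntegers.

Section Ideals.
Variable R : comNzRingType.
Implicit Types I : set R.

Definition is_ideal I :=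
  [/\ I 0, forall x y, I x -> I y -> I (x + y) & forall r x, I x -> I (r * x)].

Definition quotient_set I : set (set R) :=
  [set [set x + y | y in I] | x in [set: R]].

(* N(I) = |R / I|; it is 0 when R / I is infinite. *)
Definition ideal_norm I : nat := #|` fset_set (quotient_set I)|.

End Ideals.

Lemma Qsqrt2_exists :
  exists (K : fieldExtType rat) (s : K), s ^+ 2 = 2 /\ <<1; s>>%VS = fullv.
Proof.
have [K [QtoC [[|s []] // [Ds] genK]]] := num_field_exists [:: sqrtC 2].
exists K, s; split; last by rewrite -genK /= adjoin_seq1.
by apply: (fmorph_inj QtoC); rewrite rmorphXn rmorph_nat /= Ds sqrtCK.
Qed.

(* Main.v *)
Require Import Defs.
From mathcomp Require Import all_boot all_order all_algebra all_field.
From mathcomp Require Import finmap boolp classical_sets functions cardinality.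
From mathcomp Require Import fsbigop.
From mathcomp Require Import ring lra zify.

Import Order.TTheory GRing.Theory Num.Theory.
Local Open Scope classical_set_scope.
Local Open Scope ring_scope.

(** Both sides count the integer points (x, y) with
      x^2 - 2 y^2 = m,  x = 1 mod 4,  2 |y| < |x|,
    where m = 16 k + 1: they are the coefficient of q^k in f_1 and the number
    of ideals of norm m.

    _The q-series._  After cancellation f_1 is the sum over n of
    q^(n(n+1)/2) / ((-q)_n (1 - q^(2n+1))).  Put
      A_r = sum of q^(2ab) over a + b = r, a, b >= 0, plus
            sum of q^(2ab) over a + b = r + 1, a, b >= 1.
    The sequences (-1)^r A_r and (-1)^n / ((q^2; q^2)_n (1 - q^(2n+1))) form
    a Bailey pair ([bailey_betaE]), so f_1 is the sum over r of
    q^(r(r+1)/2) A_r ([hecke_mod]).  Two facts make the pair computable.  The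
    shift (a, b) -> (a + 1, b + 1) gives the sum [hsum] of q^(2ab) over
    a + b = r a two-step recurrence ([hsum_rec]); and
    1 / ((q)_(n-r) (q)_(n+r+1)) is, up to a factor depending on n only, a
    q-binomial coefficient, so two applications of the q-Pascal rule relate
    n + 1 to n ([kernel_rec]).  The resulting recurrence in n closes up because
    the leftover sums telescope.
    The conjugate half of Bailey's lemma is a telescoping in n
    ([bailey_gamma_rec]); everything is done with finite sums modulo q^N.
    Finally 16 (r(r+1)/2 + 2ab) + 1 = (4r + 1)^2 - 8 (a - b)^2 when
    a + b = r, and likewise with -(4r + 3) in place of 4r + 1 when
    a + b = r + 1, which lists the integer points.

    _The ideals._  The ring of integers is Z[t] with t^2 = 2
    ([sqrt2_surj]), it is norm-Euclidean, and the norm of a principal ideal is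
    the absolute value of the norm of a generator ([pideal_norm]).  As 1 + t
    has norm -1, an ideal of norm m has a generator of norm m; up to sign, the
    multiples of it by the powers of the unit 3 + 2t of norm 1 include exactly
    one x + yt in the region above: multiplication by 3 + 2t or 3 - 2t reduces
    |x| outside of it ([fund_dom_generator]), and two points in it are too close
    to differ by a unit other than 1 ([pideal_fund_dom_inj]). *)

(** * The Bailey pair and the Hecke-type expansion *)

Section QSeries.
Variables (R : comUnitRingType) (q : R).
Hypothesis q_unit : forall n, 1 - q ^+ n.+1 \is a GRing.unit.

Local Notation poch n := (qpoch q q n).

Lemma pochS n : poch n.+1 = poch n * (1 - q ^+ n.+1).
Proof. by rewrite /qpoch big_ord_recr /= exprS. Qed.

Lemma poch_unit n : poch n \is a GRing.unit.
Proof. by apply: rpred_prod => j _; rewrite -exprS. Qed.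

Definition pochV m k : R := (poch m * poch k)^-1.

Lemma pochV_Sl m k : pochV m k = pochV m.+1 k * (1 - q ^+ m.+1).
Proof.
rewrite /pochV pochS mulrAC [in RHS]invrM ?unitrM ?poch_unit ?q_unit //.
by rewrite mulrAC mulVr ?q_unit // mul1r.
Qed.

Lemma pochV_Sr m k : pochV m k = pochV m k.+1 * (1 - q ^+ k.+1).
Proof.
have VC i j : pochV i j = pochV j i by rewrite /pochV mulrC.
by rewrite VC pochV_Sl VC.
Qed.

(** The kernel of a Bailey pair relative to q, up to the factor 1 - q:
    a sequence A and its transform B satisfy B_n = sum_r kernel n r * A_r. *)
Definition kernel n r : R :=
  if (r <= n)%N then pochV (n - r) (n + r).+1 else 0.

Lemma kernelE n r m : (r + m)%N = n -> kernel n r = pochV m (n + r).+1.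
Proof. by move=> <-; rewrite /kernel leq_addr addKn. Qed.

Lemma kernel_out n r : (n < r)%N -> kernel n r = 0.
Proof. by rewrite ltnNge /kernel => /negbTE ->. Qed.

Lemma kernel_succ n r : (r <= n)%N ->
  kernel n r.+1 * (1 - q ^+ (n + r).+2) = kernel n r * (1 - q ^+ (n - r)).
Proof.
move=> /subnKC; move: (n - r)%N => [|m] Dn.
  by rewrite kernel_out ?expr0 ?subrr ?mulr0 ?mul0r //; lia.
rewrite (kernelE n r m.+1) // (kernelE n r.+1 m); last by lia.
by rewrite pochV_Sl addnS mulrAC -pochV_Sr.
Qed.

(** This is [2n+3; k] in terms of [2n+1; k], [2n+1; k-1], [2n+1; k-2], obtained
    from two q-Pascal rules, with k = n + 1 - r and the Gaussian binomial
    written as (q)_(2n+1) * kernel n r.  The kernel is symmetric under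
    r -> -1 - r, whence the value at r = -1. *)
Lemma kernel_rec n r : (r <= n.+1)%N ->
  (1 - q ^+ n.+1.*2) * (1 - q ^+ n.+1.*2.+1) * kernel n.+1 r =
  q ^+ (n + r).+2 * kernel n r.+1 + (1 + q ^+ n.+1.*2) * kernel n r
  + q ^+ (n.+1 - r) * (if r is r'.+1 then kernel n r' else kernel n 0).
Proof.
move=> /subnKC; move: (n.+1 - r)%N => m Dn.
(* All four values of the kernel are polynomial multiples of kernel n.+1 r. *)
have -> : (if r is r'.+1 then kernel n r' else kernel n 0) =
    kernel n.+1 r * (1 - q ^+ (n + r).+1) * (1 - q ^+ (n + r).+2).
  rewrite (kernelE _ _ _ Dn); case: r Dn => [|r] Dn.
    rewrite add0n in Dn; rewrite Dn (kernelE n 0 n) // !addn0.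
    by rewrite pochV_Sl pochV_Sr mulrAC.
  rewrite (kernelE n r m); last by lia.
  by rewrite addSn addnS pochV_Sr pochV_Sr mulrAC.
have -> : kernel n r = kernel n.+1 r * (1 - q ^+ m) * (1 - q ^+ (n + r).+2).
  rewrite (kernelE _ _ _ Dn); case: m Dn => [|m] Dn.
    by rewrite kernel_out ?expr0 ?subrr ?mulr0 ?mul0r //; lia.
  rewrite (kernelE n r m); last by lia.
  by rewrite addSn pochV_Sl pochV_Sr mulrAC.
have -> : kernel n r.+1 =
    kernel n.+1 r * (1 - q ^+ m) * (1 - q ^+ m.-1).
  rewrite (kernelE _ _ _ Dn); case: m Dn => [|[|m]] Dn.
  - by rewrite kernel_out ?expr0 ?subrr ?mulr0 ?mul0r //; lia.
  - by rewrite kernel_out ?expr0 ?subrr ?mulr0 //; lia.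
  rewrite (kernelE n r.+1 m); last by lia.
  by rewrite addSn addnS pochV_Sl pochV_Sl mulrAC.
have -> : q ^+ n.+1.*2 = q ^+ m * q ^+ (n + r).+1.
  by rewrite -exprD; congr (_ ^+ _); lia.
have -> : q ^+ n.+1.*2.+1 = q ^+ m * q ^+ (n + r).+2.
  by rewrite -exprD; congr (_ ^+ _); lia.
rewrite [q ^+ (n + r).+2]exprS [q ^+ (n + r).+1]exprS.
case: m {Dn} => [|m] /=; first by rewrite !expr0; ring.
rewrite [q ^+ m.+1]exprS.
by move: (q ^+ (n + r)) (q ^+ m) (kernel n.+1 r) => y z w; ring.
Qed.

(** The value at r - 1 of the extension of c to all integers that is odd under
    r -> -1 - r. *)
Definition odd_pred (c : nat -> R) r := if r is r'.+1 then c r' else - c 0%N.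

(** The adjoint form of [kernel_rec]: shifting the index moves the recurrence
    from the kernel to c.  The odd extension of c absorbs the boundary term at
    r = 0. *)
Lemma sum_kernel_rec n (c : nat -> R) :
  (1 - q ^+ n.+1.*2) * (1 - q ^+ n.+1.*2.+1) *
    (\sum_(r < n.+2) (-1) ^+ r * kernel n.+1 r * c r) =
  \sum_(r < n.+1) (-1) ^+ r * kernel n r *
    ((1 + q ^+ n.+1.*2) * c r
     - q ^+ (n + r).+1 * odd_pred c r
     - q ^+ (n - r) * c r.+1).
Proof.
pose F r : R := (-1) ^+ r * kernel n r * (q ^+ (n + r).+1 *
  odd_pred c r).
pose G r : R := (-1) ^+ r * kernel n r * ((1 + q ^+ n.+1.*2) * c r).
pose H r : R := (-1) ^+ r * kernel n r * (q ^+ (n - r) * c r.+1).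
rewrite mulr_sumr.
transitivity (\sum_(r < n.+2) (G r - F r.+1 + (if (r : nat) is r'.+1
   then - H r' else kernel n 0 * (q ^+ n.+1 * c 0%N)))).
  apply: eq_bigr => -[r /= le_rn] _.
  rewrite [_ * kernel _ _]mulrC !mulrA kernel_rec // /F /G /H /odd_pred.
  move: (q ^+ n.+1.*2) => t.
  by case: r le_rn => [|r] _; rewrite ?subn0 ?addnS ?addn0 ?subSS !exprS; ring.
rewrite big_split /= big_split /= [X in _ + X = _]big_ord_recl /=.
rewrite [X in X + _ + _]big_ord_recr /= {2}/G kernel_out // mulr0 mul0r addr0.
have -> : \sum_(r < n.+2) - F r.+1 = F 0%N - \sum_(r < n.+1) F r.
  have -> : \sum_(r < n.+1) F r = \sum_(r < n.+3) F r.
    rewrite [RHS]big_ord_recr [in RHS]big_ord_recr /= {3 4}/F.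
    by rewrite (kernel_out n n.+1) // (kernel_out n n.+2) // !mulr0 !mul0r !addr0.
  by rewrite [in RHS]big_ord_recl sumrN opprD addrA subrr add0r.
transitivity (\sum_(r < n.+1) (G r - F r - H r)); last first.
  by apply: eq_bigr => r _; rewrite /F /G /H; ring.
rewrite !big_split /= !sumrN.
have -> : F 0%N = - (kernel n 0 * (q ^+ n.+1 * c 0%N)) by rewrite /F addn0 /=; ring.
by under [\sum_(r < _) H (0 + r)%N]eq_bigr do rewrite add0n; ring.
Qed.

Lemma kernel00 : kernel 0 0 * (1 - q) = 1.
Proof.
rewrite /kernel /pochV /= subnn addn0 pochS {1 2}/qpoch big_ord0 !mul1r expr1.
by rewrite mulVr // -[q]expr1 q_unit.
Qed.

(** The inhomogeneous term in the recurrence for the Bailey pair. *)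
Definition kernel_sum n : R :=
  \sum_(r < n.+1) (-1) ^+ r * kernel n r * (q ^+ (n - r) - q ^+ (n + r).+1).

Lemma sum_telescope (G : nat -> R) n :
  \sum_(r < n) (G r - G r.+1) = G 0%N - G n.
Proof.
elim: n => [|n IHn]; first by rewrite big_ord0 subrr.
by rewrite big_ord_recr /= IHn addrA subrK.
Qed.

(** With y = q^(n-r) and z = q^(n+r+1), [sum_kernel_rec] turns the claim into
    the vanishing of the sum with weights (y - z) (1 + q - y - z), and these
    weights telescope. *)
Lemma kernel_sum_rec n : (1 - q ^+ n.+1.*2) * kernel_sum n.+1 = - kernel_sum n.
Proof.
apply: (mulrI (q_unit n.+1.*2)); rewrite mulrA [_ * (1 - _)]mulrC.
rewrite (sum_kernel_rec n (fun r => q ^+ (n.+1 - r) - q ^+ (n.+1 + r).+1)).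
apply/eqP; rewrite mulrN -subr_eq0 opprK mulr_sumr -big_split /=.
pose G r : R := (-1) ^+ r * kernel n r *
  ((q ^+ (n.+1 - r) - q ^+ (n + r).+1) * (1 - q ^+ (n + r).+1)).
rewrite (eq_bigr (fun r : 'I_n.+1 => G r - G r.+1)); last first.
  move=> [r le_rn] _; rewrite /G /= !subSS !addnS.
  have kernel1 := kernel_succ n r le_rn.
  have -> : odd_pred (fun r => q ^+ (n.+1 - r) - q ^+ (n.+1 + r).+1) r =
      q * q * q ^+ (n - r) - q ^+ (n + r).+1.
    rewrite -mulrA -!exprS; case: r le_rn {kernel1} => [|r] le_rn /=.
      by rewrite !addn0 !subn0; ring.
    by congr (_ ^+ _ - _ ^+ _); lia.
  have -> : (-1) ^+ r.+1 * kernel n r.+1 *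
        ((q ^+ (n - r) - q ^+ (n + r).+2) * (1 - q ^+ (n + r).+2)) =
      - (-1) ^+ r * (kernel n r * (1 - q ^+ (n - r))) *
        (q ^+ (n - r) - q ^+ (n + r).+2).
    by rewrite -kernel1 exprS; ring.
  have -> : q ^+ n.+1.*2.+1 = q * (q * q ^+ (n - r) * (q * q ^+ (n + r))).
    by rewrite -!exprS -exprD -exprS; congr (_ ^+ _); lia.
  have -> : q ^+ n.+1.*2 = q * q ^+ (n - r) * (q * q ^+ (n + r)).
    by rewrite -!exprS -exprD; congr (_ ^+ _); lia.
  rewrite subSn // !addSn !exprS.
  ring.
rewrite sum_telescope /G (kernel_out n n.+1) // subn0 addn0.
by rewrite subrr mul0r !mulr0 mul0r subrr.
Qed.

Lemma q2_unit n : qpoch (q ^+ 2) (q ^+ 2) n \is a GRing.unit.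
Proof.
apply: rpred_prod => j _; rewrite -exprS -exprM mulnS.
exact: q_unit (2 * j).+1.
Qed.

Lemma kernel_sumE n : kernel_sum n = (-1) ^+ n / qpoch (q ^+ 2) (q ^+ 2) n.
Proof.
elim: n => [|n IHn].
  rewrite /kernel_sum big_ord_recl big_ord0 /= subnn addn0 expr0 expr1 mul1r.
  by rewrite kernel00 addr0 /qpoch big_ord0 invr1 mulr1.
apply: (mulrI (q_unit n.*2.+1)).
rewrite -[n.*2.+2]/(n.+1.*2) kernel_sum_rec IHn.
have -> : qpoch (q ^+ 2) (q ^+ 2) n.+1 =
    (1 - q ^+ n.+1.*2) * qpoch (q ^+ 2) (q ^+ 2) n.
  by rewrite /qpoch big_ord_recr /= -exprS -exprM mul2n mulrC.
rewrite invrM ?q2_unit ?q_unit //.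
by rewrite [(-1) ^+ n.+1]exprS mulN1r [RHS]mulrC -mulrA mulrVK ?q_unit // mulNr.
Qed.

Definition hsum r : R := \sum_(a < r.+1) q ^+ (2 * a * (r - a)).

Lemma hsum0 : hsum 0 = 1.
Proof. by rewrite /hsum big_ord_recl big_ord0 addr0. Qed.

Lemma hsum1 : hsum 1 = 2.
Proof. by rewrite /hsum !big_ord_recl big_ord0 /= !muln0 addr0. Qed.

(** The two end terms a = 0 and b = 0 give 2; on the others, shift
    (a, b) to (a - 1, b - 1). *)
Lemma hsum_rec r : hsum r.+2 = 2 + q ^+ (r.*2).+2 * hsum r.
Proof.
rewrite /hsum big_ord_recl big_ord_recr /= subnn !muln0 mul0n expr0.
rewrite mulr_sumr addrCA addrC -[1 + 1]/2; congr (_ + _).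
apply: eq_bigr => -[a /= le_ar] _; rewrite -exprD; congr (_ ^+ _).
rewrite /bump /= add1n subSS subSn //.
by move/subnKC: (le_ar : (a <= r)%N) => {2}<-; nia.
Qed.

(** Since the terms with a = 0 or b = 0 contribute 2 to [hsum r.+1], the last
    two summands are the sum of q^(2ab) over a + b = r + 1 with a, b >= 1. *)
Definition hcoef r : R := hsum r + hsum r.+1 - 2.

Definition bailey_beta n : R := \sum_(r < n.+1) (-1) ^+ r * kernel n r * hcoef r.

(** Replacing r by r + 1 in the first half of the summand gives minus the second
    half, by [hsum_rec] and [kernel_succ]. *)
Lemma sum_kernel_hsum n :
  \sum_(r < n.+1) (-1) ^+ r * kernel n r *
    (q ^+ (n - r) * (1 - q ^+ (n + r).+1) * (hsum r.+1 - 2)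
     + q ^+ (n + r).+1 * (1 - q ^+ (n - r)) * hsum r) = 0.
Proof.
pose G r : R := (-1) ^+ r * kernel n r *
  (q ^+ (n - r) * (1 - q ^+ (n + r).+1) * (hsum r.+1 - 2)).
rewrite (eq_bigr (fun r : 'I_n.+1 => G r - G r.+1)); last first.
  move=> [r le_rn] _; rewrite /G /=.
  have kernel1 := kernel_succ n r le_rn.
  have -> : (-1) ^+ r.+1 * kernel n r.+1 *
      (q ^+ (n - r.+1) * (1 - q ^+ (n + r.+1).+1) * (hsum r.+2 - 2)) =
    - ((-1) ^+ r * kernel n r * (1 - q ^+ (n - r)) *
       (q ^+ (n - r.+1) * q ^+ (r.*2).+2 * hsum r)).
    by rewrite -[in RHS](mulrA _ (kernel n r)) -kernel1 hsum_rec addnS exprS; ring.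
  have [eq_rn|lt_rn] := eqVneq r n.
    by rewrite eq_rn subnn expr0; ring.
  have -> : q ^+ (n - r.+1) * q ^+ (r.*2).+2 = q ^+ (n + r).+1.
    by rewrite -exprD; congr (_ ^+ _); lia.
  ring.
rewrite sum_telescope /G (kernel_out n n.+1) // hsum1.
by rewrite subrr !mulr0 mul0r subrr.
Qed.

(** By [hsum_rec], the values of hsum at r - 1 and r + 2 that [sum_kernel_rec]
    brings in reduce to those at r and r + 1; what is left over is
    -(1 + q) times [sum_kernel_hsum]. *)
Lemma bailey_beta_rec n : (1 - q ^+ n.+1.*2) * (1 - q ^+ n.+1.*2.+1) * bailey_beta n.+1 =
  (1 - q ^+ n.*2.+1) * bailey_beta n - 2 * kernel_sum n.
Proof.
rewrite (sum_kernel_rec n hcoef); apply/eqP; rewrite -subr_eq0; apply/eqP.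
rewrite /bailey_beta /kernel_sum !mulr_sumr -!sumrB.
have T0 := congr1 ( *%R (- (1 + q))) (sum_kernel_hsum n).
rewrite mulr0 mulr_sumr in T0; rewrite -[RHS]T0.
apply: eq_bigr => -[r le_rn] _ /=.
(* The recurrence of hsum at r = -1 forces the value 0 there. *)
pose p := if r is r'.+1 then hsum r' else 0.
have Dp : q ^+ (n + r).+1 * p = q * q ^+ (n - r) * (hsum r.+1 - 2).
  rewrite /p; case: r le_rn {p} => [|r] le_rn; first by rewrite hsum1 subrr !mulr0.
  rewrite hsum_rec addrAC subrr add0r -exprS mulrA -exprD; congr (_ ^+ _ * _).
  by lia.
have -> : odd_pred hcoef r = p + hsum r - 2.
  by rewrite /p; case: r {le_rn p Dp} => [|r] //=; rewrite /hcoef hsum0 hsum1; ring.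
have -> : q ^+ n.+1.*2 = q * (q ^+ (n - r) * q ^+ (n + r).+1).
  by rewrite -exprD -exprS; congr (_ ^+ _); lia.
have -> : q ^+ n.*2.+1 = q ^+ (n - r) * q ^+ (n + r).+1.
  by rewrite -exprD; congr (_ ^+ _); lia.
have DP : q ^+ (n - r) * hsum r.+2 =
   2 * q ^+ (n - r) + q * q ^+ (n + r).+1 * hsum r.
  rewrite hsum_rec mulrDr mulrA -exprD mulrC; congr (_ + _ * _).
  by rewrite -exprS; congr (_ ^+ _); lia.
have -> : q ^+ (n + r).+1 * (p + hsum r - 2) =
   q * q ^+ (n - r) * (hsum r.+1 - 2) + q ^+ (n + r).+1 * (hsum r - 2).
  by rewrite -Dp; ring.
have -> : q ^+ (n - r) * hcoef r.+1 = q ^+ (n - r) * hsum r.+1 + q * q ^+ (n + r).+1 * hsum r.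
  by rewrite /hcoef mulrBr mulrDr DP; ring.
rewrite /hcoef; move: (q ^+ (n - r)) (q ^+ (n + r).+1) (hsum r.+1) (hsum r) => y z x t.
by ring.
Qed.

(** [bailey_beta_rec] is solved by [kernel_sum] divided by 1 - q^(2n+1), because
    then its right-hand side is -[kernel_sum]. *)
Lemma bailey_betaE n :
  bailey_beta n = (-1) ^+ n / (qpoch (q ^+ 2) (q ^+ 2) n * (1 - q ^+ n.*2.+1)).
Proof.
suff D : bailey_beta n * (1 - q ^+ n.*2.+1) = kernel_sum n.
  rewrite invrM ?q2_unit ?q_unit //.
  by rewrite [_^-1 / _]mulrC mulrA -kernel_sumE -D mulrK ?q_unit.
elim: n => [|n IHn].
  rewrite /bailey_beta /kernel_sum !big_ord_recl !big_ord0 /= /hcoef hsum0 hsum1.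
  by rewrite !addr0 expr0 expr1 /=; ring.
apply: (mulrI (q_unit n.*2.+1)).
rewrite -[n.*2.+2]/(n.+1.*2) kernel_sum_rec mulrA mulrAC bailey_beta_rec.
by rewrite -IHn; ring.
Qed.

Definition bailey_delta n : R := (-1) ^+ n * q ^+ 'C(n.+1, 2) * poch n.

Lemma bailey_deltaS n : bailey_delta n.+1 = - q ^+ n.+1 * (1 - q ^+ n.+1) * bailey_delta n.
Proof.
by rewrite /bailey_delta binS bin1 exprD pochS exprS; ring.
Qed.

(** The conjugate of the sequence delta under Bailey's lemma, which is
    (-1)^r q^(r(r+1)/2) in the limit, cut off at N to remain a finite sum. *)
Definition bailey_gamma N r : R := \sum_(n < N) bailey_delta n * kernel n r.

(** The terms of the left-hand side telescope in n: they are 1 + q^(r+1) times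
    the decrements of (-1)^n q^(n(n+1)/2) (q)_n / ((q)_(n-r-1) (q)_(n+r+1)),
    whose lower boundary value is 0. *)
Lemma bailey_gamma_rec N r : bailey_gamma N r.+1 + q ^+ r.+1 * bailey_gamma N r =
  - ((1 + q ^+ r.+1) *
     (if (r < N)%N then bailey_delta N * pochV (N - r.+1) (N + r).+1 else 0)).
Proof.
elim: N => [|N IHN]; first by rewrite /bailey_gamma !big_ord0 ltn0; ring.
rewrite /bailey_gamma !big_ord_recr /= -/(bailey_gamma N _) -/(bailey_gamma N _).
rewrite mulrDr addrACA IHN ltnS.
have [lt_Nr|] := ltnP N r.
  rewrite ifF; last by lia.
  by rewrite (kernel_out N r) // (kernel_out N r.+1) ?(leqW lt_Nr) //; ring.
move=> le_rN; rewrite subSS.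
have Dn := subnKC le_rN; move: (N - r)%N Dn => m Dn.
have -> : (if (r < N)%N then bailey_delta N * pochV (N - r.+1) (N + r).+1 else 0) =
    bailey_delta N * (pochV m (N + r).+2 * (1 - q ^+ m) * (1 - q ^+ (N + r).+2)).
  case: m Dn => [|m] Dn.
    by rewrite ifF ?expr0; [ring | lia].
  rewrite ifT; last by lia.
  have -> : (N - r.+1 = m)%N by lia.
  by rewrite pochV_Sl pochV_Sr; congr (_ * _); rewrite mulrAC.
have -> : kernel N r.+1 = pochV m (N + r).+2 * (1 - q ^+ m).
  case: m Dn => [|m] Dn; first by rewrite kernel_out ?expr0; [ring | lia].
  by rewrite (kernelE N r.+1 m) ?addnS -1?pochV_Sl //; lia.
rewrite (kernelE N r m) // (pochV_Sr m (N + r).+1) bailey_deltaS.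
have -> : q ^+ N.+1 = q * (q ^+ r * q ^+ m) by rewrite -exprD Dn exprS.
have -> : q ^+ (N + r).+2 = q * q * (q ^+ r * q ^+ m * q ^+ r).
  by rewrite -!exprD Dn -mulrA -!exprS.
rewrite exprS; move: (q ^+ r) (q ^+ m) (pochV _ _) (bailey_delta N) => x y v d.
ring.
Qed.

(** A truncation of the expansion of (1; q)_oo = 0 by Euler's formula. *)
Lemma bailey_gamma0 N : bailey_gamma N 0 = 1 - (-1) ^+ N * q ^+ 'C(N.+1, 2) / poch N.
Proof.
elim: N => [|N IHN].
  by rewrite /bailey_gamma big_ord0 /qpoch big_ord0 !expr0 invr1; ring.
rewrite /bailey_gamma big_ord_recr /= -/(bailey_gamma N 0) IHN.
have H1 : (poch N)^-1 = (poch N.+1)^-1 * (1 - q ^+ N.+1).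
  by rewrite pochS invrM ?poch_unit // mulrAC mulVr ?mul1r.
have H2 : poch N * (poch N * poch N.+1)^-1 = (poch N.+1)^-1.
  by rewrite invrM ?poch_unit // mulrCA mulrV ?poch_unit // mulr1.
rewrite /bailey_delta /kernel /pochV leq0n subn0 addn0 -[_ * poch N * _]mulrA H2 H1.
rewrite [(-1) ^+ N.+1]exprS.
have -> : q ^+ 'C(N.+2, 2) = q ^+ 'C(N.+1, 2) * q ^+ N.+1.
  by rewrite -exprD [in LHS]binS bin1.
by move: (_^-1) => b; ring.
Qed.

Lemma bailey_gamma_mod N r :
  exists h, bailey_gamma N r = (-1) ^+ r * q ^+ 'C(r.+1, 2) + q ^+ N * h.
Proof.
have qN : q ^+ 'C(N.+1, 2) = q ^+ N * q ^+ 'C(N, 2).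
  by rewrite -exprD binS bin1 addnC.
elim: r => [|r [h IHr]].
  by rewrite bailey_gamma0 qN; eexists; rewrite !expr0 mulr1; congr (_ + _);
    rewrite -mulrN mulrAC mulrCA -!mulrA; reflexivity.
have /eqP := bailey_gamma_rec N r; rewrite eq_sym -subr_eq IHr => /eqP <-.
have -> : (if (r < N)%N then bailey_delta N * pochV (N - r.+1) (N + r).+1 else 0) =
   q ^+ N * (if (r < N)%N then (-1) ^+ N * q ^+ 'C(N, 2) * poch N *
     pochV (N - r.+1) (N + r).+1 else 0).
  by case: ifP => _; rewrite ?mulr0 // /bailey_delta qN; ring.
rewrite [in X in exists h, _ = X + _]binS bin1 exprD exprS.
move: (if _ then _ else _) => h'.
rewrite [(-1) ^+ r.+1]exprS.
by exists (- (q * q ^+ r) * h - (1 + q * q ^+ r) * h'); ring.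
Qed.

(** Bailey's lemma: expand each term by [bailey_betaE] and exchange the sums. *)
Lemma hecke_mod N : exists h,
  \sum_(n < N) q ^+ 'C(n.+1, 2) / (qpoch (- q) q n * (1 - q ^+ n.*2.+1)) =
  \sum_(r < N) q ^+ 'C(r.+1, 2) * hcoef r + q ^+ N * h.
Proof.
have -> : \sum_(n < N) q ^+ 'C(n.+1, 2) / (qpoch (- q) q n * (1 - q ^+ n.*2.+1))
  = \sum_(r < N) (-1) ^+ r * hcoef r * bailey_gamma N r.
  transitivity (\sum_(n < N) \sum_(r < N) bailey_delta n * ((-1) ^+ r * kernel n r * hcoef r)).
    apply: eq_bigr => -[n /= lt_nN] _; rewrite -mulr_sumr.
    have -> : \sum_(r < N) (-1) ^+ r * kernel n r * hcoef r = bailey_beta n.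
      rewrite /bailey_beta (big_ord_widen _ (fun r => (-1) ^+ r * kernel n r * hcoef r) lt_nN) //.
      rewrite [RHS]big_mkcond; apply: eq_bigr => r _; case: ltnP => // lt_nr.
      by rewrite kernel_out // mulr0 mul0r.
    have Dq : qpoch (q ^+ 2) (q ^+ 2) n = poch n * qpoch (- q) q n.
      rewrite /qpoch -big_split; apply: eq_bigr => i _ /=.
      by rewrite -exprM mulnC exprM; ring.
    have U : qpoch (- q) q n \is a GRing.unit.
      by have := q2_unit n; rewrite Dq unitrM => /andP[].
    rewrite bailey_betaE Dq /bailey_delta !invrM ?unitrM ?poch_unit ?U ?q_unit //.
    have S : (-1) ^+ n * (-1) ^+ n = 1 :> R by rewrite -expr2 sqrr_sign.
    have := mulrV (poch_unit n); move: S (poch n)^-1 (poch n).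
    move: (qpoch (- q) q n)^-1 (1 - q ^+ n.*2.+1)^-1 (_ ^+ _) ((-1) ^+ n).
    move=> x y z s S a b Sab.
    by rewrite -[LHS]mul1r -[X in X * _]mulr1 -{1}S -Sab; ring.
  rewrite exchange_big; apply: eq_bigr => r _ /=.
  by rewrite mulr_sumr; apply: eq_bigr => n _ /=; ring.
have /fin_all_exists [h Dh] (r : 'I_N) := bailey_gamma_mod N r.
exists (\sum_(r < N) (-1) ^+ r * hcoef r * h r).
rewrite mulr_sumr -big_split; apply: eq_bigr => r _ /=; rewrite Dh.
have S : (-1) ^+ r * (-1) ^+ r = 1 :> R by rewrite -expr2 sqrr_sign.
move: S; move: ((-1) ^+ r) => s S.
by rewrite -[q ^+ 'C(r.+1, 2) in RHS]mul1r -S; ring.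
Qed.

End QSeries.

(** * The coefficients of f_1 *)

Section FpsCoefs.
Variable R : comNzRingType.

Lemma coefs_sum I (r : seq I) (Q : pred I) (F : I -> {fps R}) k :
  coefs (\sum_(i <- r | Q i) F i) k = \sum_(i <- r | Q i) coefs (F i) k.
Proof. exact: (big_morph (fun f : {fps R} => coefs f k)). Qed.

Lemma coefsXn n k : coefs (fpsX R ^+ n) k = (k == n)%:R.
Proof.
rewrite -[_ ^+ n]mulr1 coefsXnM -[coefs 1 _]/((k - n == 0)%N%:R).
by have [//|gt|->] := ltngtP k n; rewrite ?subnn // subn_eq0 leqNgt gt.
Qed.

End FpsCoefs.

Section F1.
Local Notation q := (fpsX int).

Lemma fpsX_unit n : 1 - q ^+ n.+1 \is a GRing.unit.
Proof.
by rewrite fps_unitE -[coefs _ 0]/(1 - coefs (q ^+ n.+1) 0) coefsXn subr0 unitr1.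
Qed.

Lemma f1_termE n :
  f1_term n = q ^+ 'C(n.+1, 2) / (qpoch (- q) q n * (1 - q ^+ n.*2.+1)).
Proof.
rewrite /f1_term addn1 mul2n pochS.
have -> : ((n ^ 2 + n) %/ 2)%N = 'C(n.+1, 2).
  by rewrite bin2 /= divn2 -mulnn addnC -mulSn.
have U : qpoch (- q) q n \is a GRing.unit.
  by have := f1_term_den_unit n; rewrite unitrM => /andP[].
rewrite !invrM ?unitrM ?U ?fpsX_unit ?poch_unit //; try exact: fpsX_unit.
have := mulrV (poch_unit _ _ fpsX_unit n.*2).
move: (qpoch q q n.*2) (_^-1) => x y xy.
rewrite -[RHS]mulr1 -xy; ring.
Qed.

Lemma coefs_f1_term n k : (k < n)%N -> coefs (f1_term n) k = 0.
Proof.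
move=> lt_kn; rewrite f1_termE coefsXnM ifT //; apply: leq_trans lt_kn _.
by rewrite binS bin1 leq_addl.
Qed.

(** For the coefficient of q^k the remainder q^(k+1) h of [hecke_mod] is
    invisible. *)
Lemma coefs_f1 k : coefs f1 k =
  \sum_(r < k.+1) (\sum_(a < r.+1) (k == 'C(r.+1, 2) + 2 * a * (r - a))%N%:R +
                   \sum_(a < r) (k == 'C(r.+1, 2) + 2 * a.+1 * (r - a))%N%:R).
Proof.
have -> : coefs f1 k = coefs (\sum_(n < k.+1) f1_term n) k.
  rewrite coefs_sum (fsbig_ord _ k.+1 (fun n => coefs (f1_term n) k)).
  symmetry; apply: fsbig_widen => // n [_ /negP]; rewrite -ltnNge.
  by rewrite ltnS => lt_kn; exact: coefs_f1_term.
under eq_bigr do rewrite f1_termE.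
have [h ->] := hecke_mod _ _ fpsX_unit k.+1.
rewrite -[LHS]/(coefs _ k + coefs _ k) coefsXnM ltnSn addr0 coefs_sum.
apply: eq_bigr => r _.
have -> : hcoef _ q r = \sum_(a < r.+1) q ^+ (2 * a * (r - a)) +
    \sum_(a < r) q ^+ (2 * a.+1 * (r - a)).
  rewrite /hcoef {2}/hsum big_ord_recl big_ord_recr /= subnn !muln0 expr0.
  rewrite -!addrA; congr (_ + _); rewrite addrCA -[1 + (1 - 2)]/(1 + (1 - (1 + 1))).
  rewrite opprD addNKr subrr addr0.
  by apply: eq_bigr => a _; rewrite /bump add1n subSS.
rewrite mulrDr !mulr_sumr -[LHS]/(coefs _ k + coefs _ k) !coefs_sum.
by congr (_ + _); apply: eq_bigr => a _; rewrite -exprD coefsXn.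
Qed.

End F1.

(** * The norm form x^2 - 2 y^2 *)

Definition nrm (x y : int) : int := x * x - 2 * (y * y).

Lemma nrmM x y u v :
  nrm (x * u + 2 * (y * v)) (y * u + x * v) = nrm x y * nrm u v.
Proof. by rewrite /nrm; ring. Qed.

(** Compare the parities of the 2-adic valuations of x^2 and 2 y^2. *)
Lemma nrm_eq0 x y : nrm x y = 0 -> x = 0 /\ y = 0.
Proof.
move=> /eqP; rewrite subr_eq0 => /eqP /(congr1 absz); rewrite !abszM => E.
have [y0|y_gt0] := posnP `|y|%N; first by move: E; rewrite y0; lia.
have x_gt0 : (0 < `|x|)%N by lia.
have /(congr1 odd) := congr1 (logn 2) E.
by rewrite !lognM ?muln_gt0 ?y_gt0 ?x_gt0 // !addnn /= !oddD !odd_double.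
Qed.

Lemma nearest_multiple (X n : int) : n != 0 -> exists c, 2 * `|X - c * n| <= `|n|.
Proof.
move=> n0; have n2 : 2 * `|n| != 0 by lia.
have := divz_eq (2 * X + `|n|) (2 * `|n|).
have := modz_ge0 (2 * X + `|n|) n2; have := ltz_mod (2 * X + `|n|) n2.
set c := (_ %/ _)%Z; move: (_ %% _)%Z => r r_lt r_ge E.
case: (lerP 0 n) => n_s; [exists c | exists (- c)].
  by rewrite (ger0_norm n_s) in r_lt E *; lia.
by rewrite (ltr0_norm n_s) in r_lt E *; lia.
Qed.

(** Round the quotient of u + vt by x + yt, with t^2 = 2, to the nearest point
    with integer coordinates; the error e + ft has |e|, |f| <= 1/2, so its norm
    is at most 1/2 in absolute value. *)
Lemma nrm_euclid x y u v : nrm x y != 0 -> exists c d,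
  `|nrm (u - (x * c + 2 * (y * d))) (v - (y * c + x * d))| < `|nrm x y|.
Proof.
move=> n0; have [c Dc] := nearest_multiple (u * x - 2 * (v * y)) _ n0.
have [d Dd] := nearest_multiple (v * x - u * y) _ n0.
exists c, d; rewrite -(ltr_pM2r (_ : 0 < `|nrm x y|)) ?normr_gt0 // -normrM.
have -> : nrm (u - (x * c + 2 * (y * d))) (v - (y * c + x * d)) * nrm x y =
  nrm (u * x - 2 * (v * y) - c * nrm x y) (v * x - u * y - d * nrm x y).
  by rewrite /nrm; ring.
move: Dc Dd n0; set e := _ - c * _; set f := _ - d * _.
move: e f (nrm x y) => e f N.
rewrite /nrm; nia.
Qed.

(** * Ideals of Z[t], where t^2 = 2 *)

Section Zsqrt2.
Variables (R : comNzRingType) (t : R).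
Definition zt (a b : int) : R := a%:~R + b%:~R * t.

Hypothesis t2 : t ^+ 2 = 2.
Hypothesis zt_free : forall a b, zt a b = 0 -> a = 0 /\ b = 0.
Hypothesis zt_surj : forall z : R, exists a b, z = zt a b.

Lemma ztM a b c d : zt a b * zt c d = zt (a * c + 2 * (b * d)) (b * c + a * d).
Proof.
rewrite /zt; transitivity (a%:~R * c%:~R + b%:~R * d%:~R * t ^+ 2 +
  (b%:~R * c%:~R + a%:~R * d%:~R) * t); first by ring.
by rewrite t2; ring.
Qed.

Lemma ztB a b c d : zt a b - zt c d = zt (a - c) (b - d).
Proof. by rewrite /zt; ring. Qed.

Lemma ztD a b c d : zt a b + zt c d = zt (a + c) (b + d).
Proof. by rewrite /zt; ring. Qed.

Lemma zt_inj a b c d : zt a b = zt c d -> a = c /\ b = d.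
Proof.
move=> /eqP; rewrite -subr_eq0 ztB => /eqP /zt_free [/eqP + /eqP].
by rewrite !subr_eq0 => /eqP -> /eqP ->.
Qed.

Definition pideal x y : set R := [set zt x y * w | w in [set: R]].

Lemma pideal_ideal x y : is_ideal (pideal x y).
Proof.
split.
- by exists 0; rewrite ?mulr0.
- by move=> _ _ [u _ <-] [v _ <-]; exists (u + v); rewrite ?mulrDr.
- by move=> r _ [u _ <-]; exists (r * u); rewrite // mulrCA.
Qed.

Lemma pideal_neq0 x y : nrm x y != 0 -> pideal x y <> [set 0].
Proof.
move=> n0 /seteqP[sub _].
have /zt_free[x0 y0] : zt x y = 0 by apply: sub; exists 1; rewrite ?mulr1.
by rewrite x0 y0 in n0.
Qed.

(** A nonzero element of least absolute norm generates. *)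
Lemma ideal_principal (I : set R) : is_ideal I -> I <> [set 0] ->
  exists x y, nrm x y != 0 /\ I = pideal x y.
Proof.
move=> [I0 ID IM] In0.
pose Q m := `[< exists x y, [/\ I (zt x y), nrm x y != 0 & `|nrm x y|%N = m] >].
have exQ : exists m, Q m.
  have [z Iz z0] : exists2 z, I z & z <> 0.
    apply: contrapT => nz; apply: In0; apply/seteqP; split=> z /=; last by move->.
    by move=> Iz; apply: contrapT => z0; apply: nz; exists z.
  have [a [b Dz]] := zt_surj z; exists `|nrm a b|%N; apply/asboolP.
  exists a, b; split=> //; first by rewrite -Dz.
  by apply/eqP => /nrm_eq0[a0 b0]; apply: z0; rewrite Dz a0 b0 /zt; ring.
case: (ex_minnP exQ) => _ /asboolP[x [y [Ig n0 <-]]] min_g.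
exists x, y; split=> //; apply/seteqP; split=> [z Iz|_ [w _ <-]]; last first.
  by rewrite mulrC; apply: IM.
have [u [v Dz]] := zt_surj z; have [c [d lt_cd]] := nrm_euclid x y u v n0.
exists (zt c d) => //; rewrite Dz ztM; apply/esym/eqP.
rewrite -subr_eq0 ztB; set a := u - _; set b := v - _.
have [/eqP/nrm_eq0[-> ->]|ab0] := boolP (nrm a b == 0).
  by apply/eqP; rewrite /zt; ring.
suff : (`|nrm x y| <= `|nrm a b|)%N by move: lt_cd; rewrite -/a -/b; lia.
apply: min_g; apply/asboolP; exists a, b; split=> //.
rewrite /a /b -ztB -ztM -Dz -mulN1r [zt x y * _]mulrC.
by apply: ID => //; apply/IM/IM.
Qed.

(** The Hermite normal form of the lattice spanned by g = x + yt and gt.  The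
    coefficients of t in it form the ideal (c) with c = gcd(x, y), and a Bezout
    relation for c yields an element k + ct; the integers in it are the
    multiples of e = |norm g| / c, which is g times the conjugate of g over c,
    up to sign. *)
Lemma pideal_hnf x y : nrm x y != 0 -> exists c e k : int,
  [/\ 0 < c, 0 < e, c * e = `|nrm x y| &
   forall U V, pideal x y (zt U V) <->
     exists m l, V = c * m /\ U = k * m + e * l].
Proof.
move=> n0; have [p [r Bez]] := Bezoutz x y.
have [x' Dx] := dvdzP (dvdz_gcdl x y).
have [y' Dy] := dvdzP (dvdz_gcdr x y).
set c := gcdz x y in Bez Dx Dy.
have c_ge0 : 0 <= c by [].
have c0 : c != 0 by apply: contra_neq n0 => c0; rewrite Dx Dy c0 /nrm; lia.
have Bez' : p * x' + r * y' = 1.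
  by apply: (mulIf c0); rewrite mul1r -[RHS]Bez [in RHS]Dx [in RHS]Dy; ring.
have Dn : nrm x y = c * (c * nrm x' y') by rewrite Dx Dy /nrm; ring.
pose s := Num.sg (nrm x' y').
have n0' : nrm x' y' != 0 by apply: contra_neq n0 => n0'; rewrite Dn n0' !mulr0.
have ss : s * s = 1 by rewrite -expr2 sqr_sg n0'.
have De : c * `|nrm x' y'| = s * c * nrm x' y' by rewrite [in LHS]normrEsg -/s; ring.
exists c, (c * `|nrm x' y'|), (x * r + 2 * (y * p)); split.
- by lia.
- by move: n0'; move: (nrm x' y') => n'; nia.
- by rewrite Dn !normrM (ger0_norm c_ge0).
rewrite De => U V; split.
  case=> w _; have [a [b ->]] := zt_surj w; rewrite ztM => /zt_inj[<- <-].
  exists (y' * a + x' * b), (s * (p * a - r * b)); split.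
    by rewrite Dx Dy; ring.
  have -> : s * c * nrm x' y' * (s * (p * a - r * b)) =
    c * nrm x' y' * (p * a - r * b) * (s * s) by ring.
  rewrite ss mulr1; apply/eqP; rewrite -subr_eq0 opprD addrA; apply/eqP.
  transitivity (c * (x' * a + 2 * (y' * b)) * (1 - (p * x' + r * y'))).
    by rewrite /nrm Dx Dy; ring.
  by rewrite Bez' subrr mulr0.
move=> [m [l [-> ->]]].
exists (zt r p * zt m 0 + zt (s * x') (- (s * y')) * zt l 0) => //.
rewrite !ztM ztD ztM; congr (zt _ _).
  rewrite /nrm Dx Dy; ring.
rewrite -Bez Dx Dy; ring.
Qed.

Lemma coset_eq (I : set R) z z' : is_ideal I ->
  [set z + y | y in I] = [set z' + y | y in I] <-> I (z - z').
Proof.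
move=> [I0 ID IM]; split.
  move=> /seteqP[sub _].
  have [y Iy <-] : [set z' + y | y in I] z by apply: sub; exists 0; rewrite ?addr0.
  by rewrite addrAC subrr add0r.
have sub u u' : I (u - u') -> [set u + y | y in I] `<=` [set u' + y | y in I].
  move=> Iuu' _ [y Iy <-]; exists (u - u' + y); first exact: ID.
  by ring.
move=> Izz'; apply/seteqP; split; apply: sub => //.
by rewrite -opprB -mulN1r; apply: IM.
Qed.

(** By [pideal_hnf], the i + jt with 0 <= i < e and 0 <= j < c represent each
    coset once. *)
Lemma pideal_norm x y : nrm x y != 0 -> ideal_norm (pideal x y) = `|nrm x y|%N.
Proof.
move=> n0; have [c [e [k [c_gt0 e_gt0 Dce memI]]]] := pideal_hnf x y n0.
have [I0 ID IM] := pideal_ideal x y.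
(* The pair (i, j) is encoded by the natural number j * e + i. *)
pose f m : set R := [set zt (m %% `|e|)%N (m %/ `|e|)%N + w | w in pideal x y].
apply: card_fset_set.
have -> : quotient_set (pideal x y) = f @` `I_(`|nrm x y|).
  apply/seteqP; split=> [_ [z _ <-]|_ [m _ <-]]; last first.
    by exists (zt (m %% `|e|)%N (m %/ `|e|)%N).
  have [U [V Dz]] := zt_surj z.
  pose j := (V %% c)%Z; pose m := (V %/ c)%Z.
  pose i := ((U - k * m) %% e)%Z; pose l := ((U - k * m) %/ e)%Z.
  have DV : V = m * c + j := divz_eq V c.
  have DU : U - k * m = l * e + i := divz_eq _ e.
  have j_ge0 : 0 <= j by apply: modz_ge0; lia.
  have i_ge0 : 0 <= i by apply: modz_ge0; lia.
  have lt_jc : j < c by have := ltz_mod V (lt0r_neq0 c_gt0); rewrite -/j; lia.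
  have lt_ie : i < e.
    by have := ltz_mod (U - k * m) (lt0r_neq0 e_gt0); rewrite -/i; lia.
  have lt_ie' : (`|i| < `|e|)%N by lia.
  exists (`|j| * `|e| + `|i|)%N; first by rewrite /=; nia.
  rewrite /f modnMDl divnMDl ?modn_small ?divn_small ?addn0 //; try lia.
  apply/coset_eq; first exact: pideal_ideal.
  rewrite Dz ztB; apply/memI; exists (- m), (- l); split; lia.
apply: inj_card_eq => m m'; rewrite !inE /= => lt_m lt_m' /coset_eq-/(_ (pideal_ideal x y)).
rewrite ztB => /memI[k0 [l [Ej Ei]]].
have e0 : (0 < `|e|)%N by lia.
have Em := divn_eq m `|e|; have Em' := divn_eq m' `|e|.
have := ltn_pmod m e0; have := ltn_pmod m' e0.
have : (m %/ `|e| < `|c|)%N by rewrite ltn_divLR //; nia.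
have : (m' %/ `|e| < `|c|)%N by rewrite ltn_divLR //; nia.
move: (m %/ _)%N (m %% _)%N (m' %/ _)%N (m' %% _)%N Em Em' Ej Ei => j i j' i'.
move=> -> -> Ej Ei lt_j' lt_j lt_i' lt_i.
have k00 : k0 = 0 by nia.
rewrite k00 mulr0 in Ej; rewrite k00 mulr0 add0r in Ei.
have l0 : l = 0 by nia.
by rewrite l0 mulr0 in Ei; congr (_ * _ + _)%N; lia.
Qed.

Lemma pideal_unit x y a b c d :
  zt a b * zt c d = 1 -> pideal x y = pideal (x * a + 2 * (y * b)) (y * a + x * b).
Proof.
rewrite /pideal -ztM => u1; apply/seteqP; split=> _ [w _ <-].
  by exists (zt c d * w) => //; rewrite mulrA -[zt x y * _ * _]mulrA u1 mulr1.
by exists (zt a b * w) => //; rewrite mulrA.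
Qed.

(** For n = 1 mod 16, a fundamental domain for the action of the units of
    norm 1, which are the powers of 3 + 2t up to sign, on the points of norm n:
    the condition mod 4 fixes the sign, and 3 + 2t maps the ray y / x = - 1 / 2
    to the ray y / x = 1 / 2. *)
Definition fund_dom (n : int) : set (int * int) :=
  [set p | [/\ nrm p.1 p.2 = n, exists s, p.1 = 4 * s + 1 & 2 * `|p.2| < `|p.1|]].

(** Descent on |x|.  If 2 |y| >= |x|, then multiplying by 3 + 2t or 3 - 2t,
    according to the signs, replaces |x| by |3 |x| - 4 |y||, which is smaller
    because |x| / 2 < |y| < |x|: equality is excluded as x is odd. *)
Lemma fund_dom_generator x y n : 0 < n -> nrm x y = n ->
  (exists k, x = 2 * k + 1) -> (exists k, y = 2 * k) ->
  exists2 p, fund_dom n p & pideal x y = pideal p.1 p.2.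
Proof.
move=> n_gt0; move Dm: `|x|%N => m; elim/ltn_ind: m x y Dm => m IH x y Dm Dn.
move=> [i Di] [j Dj].
have [lt_yx|le_xy] := ltP (2 * `|y|) `|x|.
  have [/eqP x1|x1] := boolP ((x %% 4)%Z == 1).
    by exists (x, y) => //; split=> //=; exists (x %/ 4)%Z; lia.
  exists (- x, - y); last first.
    rewrite /= (@pideal_unit x y (-1) 0 (-1) 0); last by rewrite ztM /zt; ring.
    by congr pideal; ring.
  split=> /=; first by rewrite -Dn /nrm; ring.
    by exists (- x %/ 4)%Z; lia.
  by rewrite !normrN.
have lt_yx : `|y| < `|x| by move: n_gt0; rewrite -Dn /nrm; nia.
pose b : int := if x * y < 0 then 2 else - 2.
have ub : zt 3 b * zt 3 (- b) = 1.
  by rewrite ztM /b; case: ifP => _; rewrite /zt; ring.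
have nb : nrm 3 b = 1 by rewrite /b; case: ifP.
rewrite (pideal_unit _ _ _ _ _ _ ub).
refine (IH _ _ (x * 3 + 2 * (y * b)) (y * 3 + x * b) erefl _ _ _).
- by rewrite /b; case: ltP => xy; nia.
- by rewrite nrmM nb mulr1.
- by exists (3 * i + y * b + 1); rewrite Di; ring.
- exists (3 * j + x * (if x * y < 0 then 1 else -1)); rewrite /b.
  by case: ifP => _; rewrite Dj; ring.
Qed.

(** If p + rt is the unit relating two points of the domain, then
    |r| n = |x y' - x' y| < |x x'|, while x^2 and x'^2 are less than 2 n; so
    |r| < 2, and r = 1 or -1 would give p^2 = 3. *)
Lemma pideal_fund_dom_inj n : 0 < n -> set_inj (fund_dom n) (fun p => pideal p.1 p.2).
Proof.
move=> n_gt0 [x y] [x' y'] /[!inE] -[/= Dn [s Ds] yx] [/= Dn' [s' Ds'] yx'] E.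
have : pideal x y (zt x' y') by rewrite E; exists 1; rewrite ?mulr1.
case=> w _; have [p [r ->]] := zt_surj w; rewrite ztM => /zt_inj[Dx' Dy'].
have nu : nrm p r = 1.
  apply: (mulfI (lt0r_neq0 n_gt0)); rewrite mulr1 -{1}Dn -nrmM Dx' Dy'; exact: Dn'.
have Dr : r * n = x * y' - x' * y by rewrite -Dn -Dx' -Dy' /nrm; ring.
have sq_lt u v : nrm u v = n -> 2 * `|v| < `|u| -> `|u| * `|u| < 2 * n.
  by move=> <-; rewrite /nrm; nia.
have r_lt2 : `|r| < 2.
  rewrite ltNge; apply/negP => r_ge2.
  have := sq_lt _ _ Dn yx; have := sq_lt _ _ Dn' yx'.
  have : `|r| * n = `|x * y' - x' * y| by rewrite -(gtr0_norm n_gt0) -normrM Dr.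
  have : `|x * y' - x' * y| <= `|x| * `|y'| + `|x'| * `|y|.
    by apply: le_trans (ler_normB _ _) _; rewrite !normrM.
  have : `|x| * (2 * `|y'|) <= `|x| * `|x'| by apply: ler_wpM2l; lia.
  have : `|x'| * (2 * `|y|) <= `|x'| * `|x| by apply: ler_wpM2l; lia.
  have : 2 * n <= `|r| * n by rewrite ler_pM2r.
  have := sqr_ge0 (`|x| - `|x'|); rewrite expr2.
  move: `|x| `|y| `|x'| `|y'| (`|r| * n) (`|_ - _|) => X Y X' Y' s0 z.
  lia.
have r0 : r = 0.
  apply: contrapT => r0; have rr : r * r = 1.
    by have [->|->] : r = 1 \/ r = -1 by lia.
  move: nu; rewrite /nrm rr => nu.
  have [p_lt2|p_ge2] := ltP `|p| 2; last by nia.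
  have : p \in [:: 0; 1; -1] by rewrite !inE; lia.
  by rewrite !inE => /or3P[] /eqP Dp; rewrite Dp in nu.
rewrite r0 /nrm in nu.
have p1 : p = 1.
  have /eqP : p ^+ 2 = 1 by rewrite expr2; lia.
  by rewrite sqrf_eq1 => /orP[] /eqP // p1; move: Dx'; rewrite p1 r0; lia.
rewrite -Dx' -Dy' r0 p1; congr (_, _); ring.
Qed.

(** The squares mod 8 leave no other choice. *)
Lemma norm_parity x y k : nrm x y = 16 * k + 1 ->
  (exists i, x = 2 * i + 1) /\ (exists j, y = 2 * j).
Proof.
rewrite /nrm => E.
have [i [Dx|Dx]] : exists i, x = 2 * i \/ x = 2 * i + 1.
- by exists (x %/ 2)%Z; lia.
- by move: E; rewrite Dx; lia.
split; first by exists i.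
have [j [Dy|Dy]] : exists j, y = 2 * j \/ y = 2 * j + 1.
- by exists (y %/ 2)%Z; lia.
- by exists j.
by move: E; rewrite Dx Dy; lia.
Qed.

(** A generator of norm -M becomes one of norm M after multiplication by the
    unit 1 + t. *)
Lemma ideals_of_norm (M : nat) : (M = 1 %[mod 16])%N ->
  set_bij (fund_dom M) [set a : set R |
    [/\ is_ideal a, a <> [set 0] & ideal_norm a = M]] (fun p => pideal p.1 p.2).
Proof.
move=> M1; have [k Dk] : exists k : int, M%:Z = 16 * k + 1.
  by exists (M %/ 16)%N%:Z; have := divn_eq M 16; rewrite M1; lia.
have M_gt0 : 0 < M%:Z by case: M M1 {Dk}.
split; last 2 first.
- exact: pideal_fund_dom_inj.
- move=> I /= [idI I0 nI]; have [x [y [n0 DI]]] := ideal_principal _ idI I0.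
  rewrite DI pideal_norm // in nI.
  have [x' [y' [Dn ->]]] : exists x' y', nrm x' y' = M /\ I = pideal x' y'.
    case: (lerP 0 (nrm x y)) => n_s; first by exists x, y; split=> //; lia.
    exists (x * 1 + 2 * (y * 1)), (y * 1 + x * 1).
    rewrite nrmM -(@pideal_unit x y 1 1 (-1) 1); last first.
      by rewrite ztM /zt; ring.
    by split=> //; rewrite (_ : nrm 1 1 = -1) //; lia.
  have [px py] := norm_parity _ _ _ (etrans Dn Dk).
  by have [p Dp ->] := fund_dom_generator _ _ _ M_gt0 Dn px py; exists p.
move=> [x y] [/= Dn _ _].
have n0 : nrm x y != 0 by rewrite Dn gt_eqF.
split; [exact: pideal_ideal | exact: pideal_neq0 |].
by rewrite pideal_norm // Dn.
Qed.

End Zsqrt2.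

Arguments zt {R} t a b.
Arguments pideal {R} t x y.

(** * The ring of integers of Q(sqrt 2) *)

Section QuadraticField.
Variables (K : fieldExtType rat) (s : K) (inj : {rmorphism rat -> K}).
Hypothesis injE : forall c, inj c = c%:A.
Hypotheses (s2 : s ^+ 2 = 2) (K_gen : <<1; s>>%VS = fullv).

Definition qs (u v : rat) : K := inj u + inj v * s.

Lemma qsD u v u' v' : qs u v + qs u' v' = qs (u + u') (v + v').
Proof. by rewrite /qs !rmorphD; ring. Qed.

Lemma qsM u v u' v' :
  qs u v * qs u' v' = qs (u * u' + 2 * (v * v')) (v * u' + u * v').
Proof.
have inj2 : inj 2 = s ^+ 2 by rewrite s2 rmorph_nat.
by rewrite /qs [inj (_ + 2 * _)]rmorphD rmorphD !rmorphM inj2; ring.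
Qed.

Lemma rat_sqr_neq2 (w : rat) : w ^+ 2 != 2.
Proof.
apply/eqP => w2; have : nrm (numq w) (denq w) = 0.
  apply: (@intr_inj rat); rewrite /nrm rmorphB /= !rmorphM /=.
  rewrite numqE; transitivity ((w ^+ 2 - 2) * (denq w)%:~R ^+ 2); first by ring.
  by rewrite w2; ring.
by case/nrm_eq0 => _ /eqP; rewrite (negbTE (denq_neq0 w)).
Qed.

Lemma qs_eq0 u v : qs u v = 0 -> u = 0 /\ v = 0.
Proof.
move=> E; have [v0|v0] := eqVneq v 0.
  move: E; rewrite /qs v0 rmorph0 mul0r addr0 => /eqP.
  by rewrite fmorph_eq0 => /eqP.
have := rat_sqr_neq2 (u / v); case/eqP; apply: (fmorph_inj inj).
rewrite rmorphXn rmorph_nat -s2.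
have -> : inj (u / v) = - s; last by rewrite sqrrN.
have v0' : inj v != 0 by rewrite fmorph_eq0.
apply: (mulIf v0'); rewrite -rmorphM mulfVK //.
by apply/eqP; rewrite mulNr -addr_eq0 [s * _]mulrC -/(qs u v) E.
Qed.

Lemma qs_surj x : exists u v, x = qs u v.
Proof.
have : x \in <<1; s>>%VS by rewrite K_gen memvf.
case/Fadjoin_polyP => p /polyOverP p1 ->; rewrite horner_coef.
elim/big_ind: _ => [|_ _ [u [v ->]] [u' [v' ->]]|i _].
- by exists 0, 0; rewrite /qs rmorph0; ring.
- by exists (u + u'), (v + v'); rewrite qsD.
have /vlineP[c ->] := p1 i; rewrite -injE; elim: (i : nat) => [|k [u [v IHk]]].
  by exists c, 0; rewrite expr0 /qs rmorph0; ring.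
exists (2 * v), u; rewrite exprSr mulrA IHk.
have Ds : s = qs 0 1 by rewrite /qs rmorph0 rmorph1; ring.
by rewrite [X in _ * X]Ds qsM; congr qs; ring.
Qed.

(** X - c divides a monic integer polynomial; by Gauss's lemma it is a rational
    multiple of an integer factor, whose leading coefficient is a unit. *)
Lemma rat_integral (c : rat) :
  integralOver (intr : int -> K) (inj c) -> exists n : int, c = n%:~R.
Proof.
case=> p p_mon pc0.
have {pc0} : root (map_poly intr p) c.
  have : root (map_poly inj (map_poly intr p)) (inj c).
    rewrite -map_poly_comp; congr (root _ _): pc0.
    by apply: eq_map_poly => n /=; rewrite rmorph_int.
  by rewrite fmorph_root.
rewrite -dvdp_XsubCl => /dvdpP_rat_int[p1 [a a0 E] [r Dp]].
have sz_p1 : size p1 = 2.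
  have := congr1 (fun p : {poly rat} => size p) E.
  by rewrite /= size_XsubC size_scale // size_map_inj_poly //; apply: intr_inj.
have E1 := congr1 (fun p : {poly rat} => p`_1) E.
have E0 := congr1 (fun p : {poly rat} => p`_0) E.
rewrite /= !coefB !coefX !coefC !coefZ !coef_map /= in E0 E1.
have : (lead_coef p1 * lead_coef r) = 1 by rewrite -lead_coefM -Dp; apply/eqP.
have -> : lead_coef p1 = p1`_1 by rewrite lead_coefE sz_p1.
move=> U; have {}U : p1`_1 = 1 \/ p1`_1 = -1.
  have : p1`_1 \is a GRing.unit by apply/unitrPr; exists (lead_coef r).
  by case/orP => /eqP; [left | right].
case: U E1 => ->; rewrite subr0 => E1.
  exists (- p1`_0); have a1 : a = 1 by move: E1; rewrite /=; lra.
  by rewrite a1 in E0; rewrite rmorphN /=; lra.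
exists (p1`_0); have a1 : a = - 1 by move: E1; rewrite rmorphN /=; lra.
by rewrite a1 in E0; lra.
Qed.

(** Conjugation s -> -s commutes with the evaluation of integer polynomials;
    coordinates make it unnecessary to construct it as an automorphism. *)
Lemma horner_conj (p : {poly int}) u v : exists a b,
  (map_poly intr p).[qs u v] = qs a b /\
  (map_poly intr p).[qs u (- v)] = qs a (- b).
Proof.
elim/poly_ind: p => [|p c [a [b [E1 E2]]]].
  by exists 0, 0; rewrite rmorph0 !horner0 oppr0 /qs rmorph0; split; ring.
exists (a * u + 2 * (b * v) + c%:~R), (b * u + a * v).
rewrite rmorphD rmorphM /= map_polyX map_polyC !hornerMXaddC E1 E2 !qsM /=.
have -> : c%:~R = qs c%:~R 0 :> K by rewrite /qs rmorph_int rmorph0; ring.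
by rewrite !qsD; split; congr qs; ring.
Qed.

Lemma integral_conj u v :
  integralOver (intr : int -> K) (qs u v) ->
  integralOver (intr : int -> K) (qs u (- v)).
Proof.
case=> p p_mon px0; exists p => //; have [a [b [E1 E2]]] := horner_conj p u v.
move: px0; rewrite /root E1 E2 => /eqP /qs_eq0[-> ->].
by rewrite oppr0 /qs rmorph0; apply/eqP; ring.
Qed.

(** The trace 2u and the norm u^2 - 2 v^2 are integers, hence so is (4v)^2 and
    thus 4v; congruences modulo powers of 2 then force u and v to be integers. *)
Lemma integral_qs u v : integralOver (intr : int -> K) (qs u v) ->
  exists a b : int, u = a%:~R /\ v = b%:~R.
Proof.
move=> Ix; have Iy := integral_conj _ _ Ix.
have [n1 D1] : exists n : int, 2 * u = n%:~R.
  apply: rat_integral; have := integral_add Ix Iy.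
  by rewrite qsD addrN /qs rmorph0 mul0r addr0 (_ : u + u = 2 * u) //; ring.
have [n2 D2] : exists n : int, u ^+ 2 - 2 * v ^+ 2 = n%:~R.
  apply: rat_integral; have := integral_mul Ix Iy.
  rewrite qsM (_ : v * u + u * - v = 0); last by ring.
  rewrite (_ : u * u + _ = u ^+ 2 - 2 * v ^+ 2); last by ring.
  by rewrite /qs rmorph0 mul0r addr0.
have D8 : (2 * (n1 ^+ 2 - 4 * n2))%:~R = (4 * v) ^+ 2 :> rat.
  by rewrite rmorphM rmorphB rmorphXn rmorphM /= -D1 -D2; ring.
have [n4 D4] : exists n : int, 4 * v = n%:~R.
  apply: rat_integral; exists ('X^2 - (2 * (n1 ^+ 2 - 4 * n2))%:P).
    by rewrite monicXnsubC.
  rewrite rmorphB /= map_polyXn map_polyC /root hornerD hornerN hornerXn hornerC.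
  rewrite subr_eq0 -rmorphXn /= -(rmorph_int inj) D8; exact: eqxx.
have En : n4 * n4 = 2 * (n1 * n1 - 4 * n2).
  by apply: (@intr_inj rat); rewrite -expr2 D8 rmorphM /= -D4; ring.
have [c [Dc|Dc]] : exists c, n4 = 2 * c \/ n4 = 2 * c + 1.
- by exists (n4 %/ 2)%Z; lia.
- have [a [Da|Da]] : exists a, n1 = 2 * a \/ n1 = 2 * a + 1.
  + by exists (n1 %/ 2)%Z; lia.
  + have [b [Db|Db]] : exists b, c = 2 * b \/ c = 2 * b + 1.
    * by exists (c %/ 2)%Z; lia.
    * exists a, b; move: D1 D4; rewrite Da Dc Db !rmorphM /= => D1 D4.
      by split; lra.
    * by rewrite Dc Da Db in En; lia.
  + by rewrite Dc Da in En; lia.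
- by rewrite Dc in En; lia.
Qed.

Lemma integral_s : s \in @int_pred K.
Proof.
apply/asboolP; exists ('X^2 - 2%:P); first by rewrite monicXnsubC.
by rewrite rmorphB /= map_polyXn map_polyC /root !hornerE s2 subrr.
Qed.

Definition sqrt2 : ringOfIntegers K := RingOfIntegers integral_s.

Lemma sqrt2_sqr : sqrt2 ^+ 2 = 2.
Proof. by apply: val_inj; rewrite rmorphXn rmorph_nat /= s2. Qed.

Lemma val_zt a b : \val (zt sqrt2 a b) = qs a%:~R b%:~R.
Proof. by rewrite /zt rmorphD rmorphM !rmorph_int /qs !rmorph_int. Qed.

Lemma sqrt2_free a b : zt sqrt2 a b = 0 -> a = 0 /\ b = 0.
Proof.
move/(congr1 val); rewrite val_zt rmorph0 => /qs_eq0[/eqP + /eqP].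
by rewrite !intr_eq0 => /eqP -> /eqP ->.
Qed.

Lemma sqrt2_surj (z : ringOfIntegers K) : exists a b, z = zt sqrt2 a b.
Proof.
have [u [v Dz]] := qs_surj (val z).
have : integralOver (intr : int -> K) (val z) by apply/asboolP; exact: (valP z).
rewrite Dz => /integral_qs [a [b [Du Dv]]].
by exists a, b; apply: val_inj; rewrite val_zt Dz Du Dv.
Qed.

End QuadraticField.

(** * Matching the two counts *)

(** The points for a term q^(2ab) of the two parts of [hcoef _ _ r]: with b = r - a,
    y = 2 (a - b) for [pt1], and for [pt2], where the term is
    q^(2(a+1)b), y = 2 ((a + 1) - b). *)
Definition pt1 (r a : nat) : int * int := (4 * r%:Z + 1, 4 * a%:Z - 2 * r%:Z).
Definition pt2 (r a : nat) : int * int :=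
  (- (4 * r%:Z + 3), 4 * a%:Z + 2 - 2 * r%:Z).

Definition points (k : nat) : seq (int * int) :=
  [seq p <- [seq pt1 r a | r <- index_iota 0 k.+1, a <- index_iota 0 r.+1] ++
            [seq pt2 r a | r <- index_iota 0 k.+1, a <- index_iota 0 r]
   | nrm p.1 p.2 == (16 * k + 1)%N].

Lemma triangular r : (2 * 'C(r.+1, 2) = r * r.+1)%N.
Proof. by elim: r => // r IHr; rewrite binS bin1 mulnDr IHr; lia. Qed.

Lemma nrm_pt1 k r a : (a <= r)%N ->
  (nrm (pt1 r a).1 (pt1 r a).2 == (16 * k + 1)%N) =
  (k == 'C(r.+1, 2) + 2 * a * (r - a))%N.
Proof.
have := triangular r; move: 'C(_, _) => c Dc /subnKC.
by move: (r - a)%N => b Dr; rewrite -Dr in Dc *; rewrite /nrm /=; lia.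
Qed.

Lemma nrm_pt2 k r a : (a < r)%N ->
  (nrm (pt2 r a).1 (pt2 r a).2 == (16 * k + 1)%N) =
  (k == 'C(r.+1, 2) + 2 * a.+1 * (r - a))%N.
Proof.
have := triangular r; move: 'C(_, _) => c Dc /ltnW/subnKC.
by move: (r - a)%N => b Dr; rewrite -Dr in Dc *; rewrite /nrm /=; lia.
Qed.

Lemma coefs_f1_points k : coefs f1 k = \sum_(p <- points k) 1.
Proof.
rewrite coefs_f1 big_split /= /points big_filter [RHS]big_mkcond big_cat.
rewrite !big_allpairs_dep !big_mkord.
congr (_ + _); apply: eq_bigr => r _; rewrite big_mkord;
  apply: eq_bigr => a _.
  by rewrite (nrm_pt1 k r a (ltn_ord a)); case: (k == _).
by rewrite (nrm_pt2 k r a (ltn_ord a)); case: (k == _).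
Qed.

Lemma uniq_points k : uniq (points k).
Proof.
rewrite filter_uniq // cat_uniq; apply/and3P; split.
- apply: allpairs_uniq_dep => [|r _|]; rewrite ?iota_uniq //.
  by move=> [r a] [r' a'] _ _ /= []; move=> ? ?; have [-> ->] : r = r' /\ a = a' by lia.
- apply/hasPn => p /allpairsPdep[r [a [_ _ ->]]]; apply/negP.
  by move=> /allpairsPdep[r' [a' [_ _ []]]]; lia.
- apply: allpairs_uniq_dep => [|r _|]; rewrite ?iota_uniq //.
  by move=> [r a] [r' a'] _ _ /= []; move=> ? ?; have [-> ->] : r = r' /\ a = a' by lia.
Qed.

(** Let x = 4s + 1 and y = 2d.  The norm equation makes d and s congruent mod 2,
    and 2 |y| < |x| says |d| <= s if s >= 0, and |d| < -s otherwise: these are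
    the ranges of a in [pt1] with r = s and [pt2] with r = - s - 1.  It also
    gives r <= k. *)
Lemma points_fund_dom k : [set` points k] = fund_dom (16 * k + 1)%N.
Proof.
apply/seteqP; split=> [p /=|[x y] [/= Dn [s /= Ds] xy]].
  rewrite mem_filter mem_cat => /andP[/eqP Dn /orP[]] /allpairsPdep[r [a [_ +]]];
    rewrite mem_index_iota => lt_ar Dp; split=> //; rewrite Dp /=.
  - by exists r%:Z.
  - by lia.
  - by exists (- r%:Z - 1); lia.
  - by lia.
have [_ [d Dd]] := norm_parity x y k%:Z Dn.
have Ed : d * d = 2 * (s * s) + s - 2 * k%:Z.
  by move: Dn; rewrite /= /nrm Ds Dd; lia.
have [e De] : exists e, d = s + 2 * e.
  have [e [De|De]] : exists e, d = s + 2 * e \/ d = s + 2 * e + 1.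
  - by exists ((d - s) %/ 2)%Z; lia.
  - by exists e.
  have [f [Df|Df]] : exists f, s = 2 * f \/ s = 2 * f + 1.
  - by exists (s %/ 2)%Z; lia.
  - by rewrite De Df in Ed; lia.
  - by rewrite De Df in Ed; lia.
rewrite /mkset /= mem_filter Dn eqxx mem_cat; apply/orP.
case: (lerP 0 s) => s_s.
  have : 0 <= (s - d) * (s + d) by apply: mulr_ge0; lia.
  have : 0 <= s * (s - 1) by have [->|] := eqVneq s 0 => // ?; apply: mulr_ge0; lia.
  move=> ss ds; left; apply/allpairsPdep; exists `|s|%N, `|(s + e)%R|%N.
  by rewrite !mem_index_iota; split; [lia | lia | congr (_, _); lia].
have : 0 <= (- s - 1 - d) * (- s - 1 + d) by apply: mulr_ge0; lia.
have : 0 <= (- s) * (- s - 1) by apply: mulr_ge0; lia.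
move=> ss ds; right; apply/allpairsPdep; exists `|(- s - 1)%R|%N, `|(e - 1)%R|%N.
by rewrite !mem_index_iota; split; [lia | lia | congr (_, _); lia].
Qed.

Lemma coefs_Xf1 m : coefs (fpsX int * fps_subst_pow 16 f1) m =
  if (m %% 16 == 1)%N then coefs f1 (m %/ 16) else 0.
Proof.
rewrite -[fpsX int]expr1 coefsXnM; case: m => [|m] //=.
rewrite subn1 /=; have -> : (16 %| m)%N = (m.+1 %% 16 == 1)%N by lia.
by case: ifP => // ?; congr (coefs f1 _); lia.
Qed.

Theorem theorem1p1 (K : fieldExtType rat) (s : K)
    (s_sqrt2 : s ^+ 2 = 2) (K_gen : <<1; s>>%VS = fullv) :
  let ideals := [set a : set (ringOfIntegers K) |
    [/\ is_ideal a, a <> [set 0] & ideal_norm a = 1 %[mod 16]]] in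
  fps_summable ideals (fun a => fpsX int ^+ ideal_norm a) /\
  fpsX int * fps_subst_pow 16 f1 =
    fps_sum ideals (fun a => fpsX int ^+ ideal_norm a).
Proof.
move=> ideals.
pose J m := [set a : set (ringOfIntegers K) |
  [/\ is_ideal a, a <> [set 0] & ideal_norm a = m]].
pose phi p := pideal (sqrt2 K s s_sqrt2) p.1 p.2.
have J_bij k : set_bij [set` points k] (J (16 * k + 1)%N) phi.
  rewrite points_fund_dom; apply: ideals_of_norm; last by lia.
  - exact: sqrt2_sqr.
  - exact: (sqrt2_free K s (in_alg K)).
  - exact: (sqrt2_surj K s (in_alg K)).
have J_out m : ~ (m = 1 %[mod 16])%N -> ideals `&` J m = set0.
  by move=> m1; apply/seteqP; split=> // a [[_ _ a1] [_ _ am]]; rewrite am in a1.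
have coefs_norm m (a : set (ringOfIntegers K)) :
    coefs (fpsX int ^+ ideal_norm a) m != 0 -> ideal_norm a = m.
  by rewrite coefsXn; case: (m =P _) => [->|_ /eqP[]].
split=> [m|].
  apply: (@sub_finite_set _ _ (ideals `&` J m)).
    by move=> a /= [[aI a0 a1] /coefs_norm Da]; split; split.
  have [m1|/J_out ->] := pselect (m = 1 %[mod 16])%N; last exact: finite_set0.
  apply: (@sub_finite_set _ _ (J m)); first exact: subIsetr.
  have -> : m = (16 * (m %/ 16) + 1)%N by lia.
  apply: sub_finite_set (set_bij_surj (J_bij _)) _.
  exact/finite_image/finite_seq.
apply: fpsP => m; rewrite coefs_Xf1 [RHS]/=.
case: eqP => m1; last first.
  symmetry; apply: fsbig1 => a [_ _ a1]; rewrite coefsXn; case: eqP => // Dm.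
  by case: m1; rewrite Dm.
have Dm : m = (16 * (m %/ 16) + 1)%N by lia.
rewrite coefs_f1_points -(fsbig_widen (J m)); last 2 first.
- by move=> a [aI a0 Da]; split=> //; rewrite Da.
- move=> a [[aI a0 _] Ja] /=; apply/eqP/negPn/negP => /coefs_norm Da.
  by apply: Ja.
rewrite [J m](_ : _ = J (16 * (m %/ 16) + 1)%N); last by rewrite -Dm.
rewrite (reindex_fsbig _ _ _ _ (J_bij _)) -fsbig_seq ?uniq_points //.
rewrite big_seq [RHS]big_seq; apply: eq_bigr => p Dp.
have [_ _ Np] := set_bij_homo (J_bij (m %/ 16)%N) Dp.
by rewrite Np -Dm coefsXn eqxx.
Qed.
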